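(* Let $x\in\mathbb{R}_+^2$ with $x(1)+x(2)<1$ and $x_n=\lfloor nx\rfloor$ (componentwise). For any $\epsilon>0$ there is $N>0$ such that for all $n>N$ $$P_{x_n}(\sigma_1<\sigma_{1,2}<\tau_n<\tau_0)\le e^{-n(\gamma-\epsilon)}.$$
   Context: Let $\lambda,\mu_1,\mu_2>0$ with $\lambda+\mu_1+\mu_2=1$, $\lambda<\mu_1$, $\lambda<\mu_2$; $\rho_i=\lambda/\mu_i$ and $\gamma=-\max(\log\rho_1,\log\rho_2)$. Let $I_0,I_1,\dots$ be i.i.d. taking values $(1,0)$, $(-1,1)$, $(0,-1)$ with probabilities $\lambda,\mu_1,\mu_2$. The two dimensional tandem walk $X$ on $\mathbb{Z}_+^2$ is: $X_{k+1}=X_k+I_k$ if $X_k+I_k\in\mathbb{Z}_+^2$, $X_{k+1}=X_k$ otherwise; $P_x$ is the probability when $X_0=x$. $\tau_n=\inf\{k:X_k(1)+X_k(2)=n\}$, $\tau_0=\inf\{k:X_k=0\}$, $\sigma_1=\inf\{k:X_k(1)=0\}$, $\sigma_{1,2}=\inf\{k>\sigma_1:X_k(2)=0\}$. *)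

(* Defs.v *)
From HB Require Import structures.
From mathcomp Require Import all_boot all_order all_algebra finmap.
From mathcomp Require Import all_classical all_reals all_analysis.

Set Implicit Arguments.
Unset Strict Implicit.
Unset Printing Implicit Defensive.

Import Order.TTheory GRing.Theory Num.Theory.

Local Open Scope classical_set_scope.
Local Open Scope ring_scope.

(* The library puts the discrete sigma-algebra on [nat] but not on [int]; with
   this instance [int * int] gets the product sigma-algebra, which is discrete
   as well since [int] is countable. *)
HB.instance Definition _ := isPointed.Build int 0.
HB.instance Definition _ := @isMeasurable.Build default_measure_display
  int discrete_measurable discrete_measurable0
  discrete_measurableC discrete_measurableU.

Definition mutually_independent d d' (T : measurableType d)
    (S : measurableType d') (R : realType) (P : probability T R)
    (I : nat -> {RV P >-> S}) : Prop :=
  forall (J : {fset nat}) (A : nat -> set S), (forall k, measurable (A k)) ->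
    (P (\bigcap_(k in [set` J]) (I k @^-1` A k)) =
     \prod_(k <- J) P (I k @^-1` A k))%E.

Definition increment_law d (T : measurableType d) (R : realType)
    (P : probability T R) (lambda mu1 mu2 : R) (Y : {RV P >-> (int * int)%type})
    : Prop :=
  [/\ distribution P Y [set (1, 0)] = lambda%:E,
      distribution P Y [set (-1, 1)] = mu1%:E &
      distribution P Y [set (0, -1)] = mu2%:E].

Definition in_quadrant (z : int * int) : bool := (0 <= z.1) && (0 <= z.2).

(* The increments [I] are those of one sample path, and [x] is the start. *)
Fixpoint tandem_walk (I : nat -> int * int) (x : int * int) (k : nat)
    : int * int :=
  if k is k'.+1 then
    let X := tandem_walk I x k' in
    if in_quadrant (X + I k') then X + I k' else X
  else x.

Section hitting_times.
Variable R : realType.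
Implicit Type X : nat -> int * int.

(* The infimum of a set of times, in the extended reals; it is +oo when the set
   is empty. *)
Definition first_time (Q : set nat) : \bar R :=
  ereal_inf [set (k%:R)%:E | k in Q].

Definition tau X (n : nat) : \bar R :=
  first_time [set k | (X k).1 + (X k).2 = n%:Z].

Definition tau0 X : \bar R := first_time [set k | X k = (0, 0)].

Definition sigma1 X : \bar R := first_time [set k | (X k).1 = 0].

Definition sigma12 X : \bar R :=
  first_time [set k | (sigma1 X < (k%:R)%:E)%E /\ (X k).2 = 0].

End hitting_times.

Definition decay_rate (R : realType) (lambda mu1 mu2 : R) : R :=
  - Num.max (ln (lambda / mu1)) (ln (lambda / mu2)).

Definition scaled_start (R : realType) (x : R * R) (n : nat) : int * int :=
  (Num.floor (n%:R * x.1), Num.floor (n%:R * x.2)).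

(* Main.v *)
Require Import Defs.
From mathcomp Require Import all_boot all_order all_algebra finmap.
From mathcomp Require Import all_classical all_reals all_analysis.
From mathcomp Require Import ring lra zify.

Import Order.TTheory GRing.Theory Num.Theory.

Local Open Scope classical_set_scope.
Local Open Scope ring_scope.

(** Why the estimate holds.  Fix [alpha] with [1 < alpha < mu_i / lambda] for
    [i = 1, 2]; as [alpha] increases to [min (mu1 / lambda) (mu2 / lambda)],
    [ln alpha] increases to the decay rate, so it is enough to bound the
    probability by [alpha ^- n] times a factor that is linear in [n].  This is
    done by optional stopping, with one nonnegative function for each of the
    three stages of the event, superharmonic for the walk as long as that stage
    lasts.

    Stage three (from the visit of [x2 = 0] up to the exit) needs a function
    [f] that is superharmonic at every point but the origin, since both axes
    may be visited again.  Off the horizontal axis [alpha ^ (x1 + x2)] is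
    strictly superharmonic; it grows on that axis, where [alpha ^ x1], equal to
    it there, has a negative drift that compensates.  In turn [alpha ^ x1] has
    a bounded positive drift on the vertical axis, which the first function
    absorbs except at finitely many points near the origin.  There a bounded
    function of fast geometric decay takes over.  The sum [f] dominates
    [alpha ^ (x1 + x2)], hence exceeds [alpha ^ n] on the exit line, and it is
    at most [C * alpha ^ x1] on the horizontal axis
    ([escape_superharmonic]).

    Stage two (from the visit of [x1 = 0] to that of [x2 = 0]) never sees the
    horizontal axis.  There [x1 + x2] has the constant drift
    [lambda - mu2 < 0], including on the vertical axis, and a multiple of it
    added to [alpha ^ x1] pays for the positive drift of the latter
    ([tilt_superharmonic]).  The resulting function dominates the bound of
    stage three on the horizontal axis, but at a point [(0, h)] it is only of
    order [1 + h].  This is the heart of the matter: before the visit of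
    [x2 = 0] the walk loses any advantage that its starting point gave it.  As
    [h <= n] at the end of stage one, a constant serves for that stage.

    The stages are put together by [visit_then_bound].  The estimates concern
    the finite recursion [walk_prob], which averages over words of
    increments; [prob_word_le] relates it to the given probability space and
    [hitting_order_crossing] expresses the event through finite pieces of the
    path. *)

(** * Superharmonic functions of the tandem walk *)
Section Drift.
Context {R : realType} (lambda mu1 mu2 : R).

(** The one-step transition operator of the walk on the quadrant: a service at
    an empty queue leaves the state unchanged. *)
Definition mean_step (f : nat -> nat -> R) (a b : nat) : R :=
  lambda * f a.+1 b
  + mu1 * (if a is a'.+1 then f a' b.+1 else f a b)
  + mu2 * (if b is b'.+1 then f a b' else f a b).

Lemma mean_stepD f g a b :
  mean_step (fun a b => f a b + g a b) a b = mean_step f a b + mean_step g a b.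
Proof. by rewrite /mean_step; case: a => [|a]; case: b => [|b]; ring. Qed.

Lemma mean_stepZ c f a b :
  mean_step (fun a b => c * f a b) a b = c * mean_step f a b.
Proof. by rewrite /mean_step; case: a => [|a]; case: b => [|b]; ring. Qed.

Context (rates_sum1 : lambda + mu1 + mu2 = 1).

Let mu1E : mu1 = 1 - lambda - mu2.
Proof. by rewrite -rates_sum1; ring. Qed.

Lemma mean_step_const c a b : mean_step (fun _ _ => c) a b = c.
Proof.
by rewrite /mean_step; case: a => [|a]; case: b => [|b];
  rewrite -!mulrDl rates_sum1 mul1r.
Qed.

Lemma mean_step_length a b :
  mean_step (fun a b => (a + b)%:R) a b.+1 = (a + b.+1)%:R - (mu2 - lambda).
Proof.
rewrite /mean_step mu1E; case: a => [|a].
  by rewrite !add0n add1n -!natr1; ring.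
by rewrite !(addSn, addnS) -!natr1; ring.
Qed.

Context (alpha : R) (alpha_neq0 : alpha != 0).

(** [decay mu1] and [decay mu2] are the relative losses in one step of
    [alpha ^ x1] where the first queue is busy and of [alpha ^ (x1 + x2)] where
    the second one is; [growth] is the relative gain of either function where
    that queue is idle. *)
Definition decay (mu : R) : R := (1 - alpha^-1) * (mu - lambda * alpha).

Definition growth : R := lambda * (alpha - 1).

Lemma mean_step_total_busy a b :
  mean_step (fun a b => alpha ^+ (a + b)) a b.+1
  = (1 - decay mu2) * alpha ^+ (a + b.+1).
Proof.
rewrite /mean_step /decay mu1E; case: a => [|a].
  by rewrite !(addSn, addnS, add0n) !exprS; field.
by rewrite !(addSn, addnS) !exprS; field.
Qed.

Lemma mean_step_total_idle a :
  mean_step (fun a b => alpha ^+ (a + b)) a 0%N = (1 + growth) * alpha ^+ a.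
Proof.
rewrite /mean_step /growth mu1E; case: a => [|a].
  by rewrite !(addSn, addnS, addn0) !exprS; ring.
by rewrite !(addSn, addnS, addn0) !exprS; ring.
Qed.

Lemma mean_step_first_busy a b :
  mean_step (fun a _ => alpha ^+ a) a.+1 b = (1 - decay mu1) * alpha ^+ a.+1.
Proof.
rewrite /mean_step /decay (_ : mu2 = 1 - lambda - mu1); last first.
  by rewrite mu1E; ring.
by case: b => [|b]; rewrite !exprS; field.
Qed.

Lemma mean_step_first_idle b :
  mean_step (fun a _ => alpha ^+ a) 0%N b = 1 + growth.
Proof.
by rewrite /mean_step /growth mu1E; case: b => [|b]; rewrite expr1 expr0; ring.
Qed.

End Drift.

Lemma expr_unbounded (R : realType) (x y : R) :
  1 < x -> exists m : nat, y <= x ^+ m.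
Proof.
move=> x1; have lnx : 0 < ln x by rewrite ln_gt0.
exists (Num.bound (y / ln x)).
rewrite -{1}(lnK (_ : x \in Num.pos)) ?posrE ?(lt_trans ltr01) //.
rewrite -expRM_natl; apply: le_trans (expR_ge1Dx _).
have /ltW : y / ln x < (Num.bound (y / ln x))%:R by exact: unstable.ltr_bound.
by rewrite ler_pdivrMr // => /le_trans; apply; rewrite lerDr.
Qed.

Section EscapeFunctions.
Context {R : realType} (lambda mu1 mu2 : R).
Context (lambda_gt0 : 0 < lambda) (mu1_gt0 : 0 < mu1) (mu2_gt0 : 0 < mu2).
Context (rates_sum1 : lambda + mu1 + mu2 = 1) (stable1 : lambda < mu1).

(** Subharmonic off the origin, because a service brings the walk closer to the
    origin and multiplies the function by two at the first queue and by
    [mu2^-1] at the second.  Where the second queue is busy, its service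
    alone makes up for the present value; where it is empty the doubling does,
    as [lambda < mu1]. *)
Definition barrier a b : R := (mu2 / 2) ^+ a * mu2 ^+ b.

Let mu2_lt1 : mu2 < 1.
Proof. by rewrite -rates_sum1 ltrDr addr_gt0. Qed.

Lemma barrier_ge0 a b : 0 <= barrier a b.
Proof. by rewrite mulr_ge0 ?exprn_ge0 ?divr_ge0 ?ltW. Qed.

Lemma barrier_le1 a b : barrier a b <= 1.
Proof.
have s1 : mu2 / 2 <= 1.
  by rewrite ler_pdivrMr // mul1r (le_trans (ltW mu2_lt1)) ?ler1n.
have s0 : 0 <= mu2 / 2 by rewrite divr_ge0 ?ltW.
have [m0 m1] := (ltW mu2_gt0, ltW mu2_lt1).
by rewrite mulr_ile1 ?exprn_ge0 ?exprn_ile1.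
Qed.

Lemma mean_step_barrier a b : (0 < a + b)%N ->
  barrier a b <= mean_step lambda mu1 mu2 barrier a b.
Proof.
have lam : lambda = 1 - mu1 - mu2 by rewrite -rates_sum1; ring.
rewrite /mean_step -subr_ge0; case: a => [|a]; case: b => [|b] // _.
- rewrite [leRHS](_ : _ = lambda * barrier 1 b.+1 + mu1 * barrier 0 b.+1).
    by apply: addr_ge0; apply: mulr_ge0; rewrite ?barrier_ge0 ?ltW.
  by rewrite /barrier !exprS; ring.
- rewrite [leRHS](_ : _ = lambda * barrier a.+2 0
      + (mu1 - lambda) * barrier a.+1 0).
    by apply: addr_ge0; apply: mulr_ge0; rewrite ?barrier_ge0 ?subr_ge0 ?ltW.
  by rewrite /barrier !exprS lam; field.
- rewrite [leRHS](_ : _ = lambda * barrier a.+2 b.+1 + mu1 * barrier a b.+2).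
    by apply: addr_ge0; apply: mulr_ge0; rewrite ?barrier_ge0 ?ltW.
  by rewrite /barrier !exprS; field.
Qed.

(** On the vertical axis the idle first server leaves the present value in place,
    and this is a strict gain.  It compensates positive drifts near the
    origin. *)
Lemma mean_step_barrier_idle b :
  barrier 0 b.+1 + mu1 * mu2 ^+ b.+1
  <= mean_step lambda mu1 mu2 barrier 0 b.+1.
Proof.
rewrite /mean_step -subr_ge0 [leRHS](_ : _ = lambda * barrier 1 b.+1).
  by rewrite mulr_ge0 ?barrier_ge0 ?ltW.
by rewrite /barrier !exprS; ring.
Qed.

Context (alpha : R) (alpha_gt1 : 1 < alpha).
Context (alpha_lt1 : lambda * alpha < mu1) (alpha_lt2 : lambda * alpha < mu2).

Let alpha_gt0 : 0 < alpha.
Proof. exact: lt_trans alpha_gt1. Qed.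

Let alpha_neq0 : alpha != 0.
Proof. by rewrite gt_eqF. Qed.

Lemma growth_gt0 : 0 < growth lambda alpha.
Proof. by rewrite mulr_gt0 ?subr_gt0. Qed.

Lemma decay_gt0 mu : lambda * alpha < mu -> 0 < decay lambda alpha mu.
Proof. by move=> ?; rewrite mulr_gt0 ?subr_gt0 ?invf_lt1. Qed.

(** [f = alpha ^ (a + b) + A * alpha ^ a + B * (1 - barrier a b)].  The constant
    [A] balances the drifts of the first two terms on the horizontal axis, and
    [B] covers the finitely many points of the vertical axis at which
    [alpha ^ b] is too small to absorb the gain of the second term. *)
Lemma escape_superharmonic :
  exists2 C : R, 0 <= C &
  exists f : nat -> nat -> R,
  [/\ forall a b, (0 < a + b)%N -> mean_step lambda mu1 mu2 f a b <= f a b,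
      forall a b, alpha ^+ (a + b) <= f a b &
      forall a, f a 0%N <= C * alpha ^+ a].
Proof.
set step := mean_step lambda mu1 mu2.
have K0 := growth_gt0; set K := growth _ _ in K0.
have := decay_gt0 _ alpha_lt1; have := decay_gt0 _ alpha_lt2.
set d2 := decay _ _ mu2; set d1 := decay _ _ mu1 => d2_gt0 d1_gt0.
have pow0 k : 0 <= alpha ^+ k by rewrite exprn_ge0 ?ltW.
have d2pow k : 0 <= d2 * alpha ^+ k by apply: mulr_ge0; first exact: ltW.
pose A := K / d1.
have A0 : 0 < A by rewrite divr_gt0.
have AE : A * d1 = K by rewrite divfK ?gt_eqF.
have [m Hm] := expr_unbounded _ alpha (A * K / d2) alpha_gt1.
have rate0 : 0 < mu1 * mu2 ^+ m by rewrite mulr_gt0 ?exprn_gt0.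
pose B := A * K / (mu1 * mu2 ^+ m).
have B0 : 0 < B by rewrite divr_gt0 // mulr_gt0.
have BE : B * (mu1 * mu2 ^+ m) = A * K by rewrite divfK ?gt_eqF.
(* The positive drift [A * K] of the second term on the vertical axis is
   absorbed by the first term from height [m] on and by the barrier below. *)
have key b : A * K <= d2 * alpha ^+ b.+1 + B * (mu1 * mu2 ^+ b.+1).
  have [mb|/ltnW bm] := leqP m b.+1.
    apply: ler_wpDr.
      by apply: mulr_ge0; [exact: ltW|rewrite mulr_ge0 ?exprn_ge0 ?ltW].
    by rewrite -ler_pdivrMl // mulrC (le_trans Hm) // ler_eXn2l.
  apply: ler_wpDl; first exact: d2pow.
  rewrite -BE ler_pM2l // ler_pM2l //.
  by apply: ler_wiXn2l; [exact: ltW|exact: ltW|].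
exists (1 + A + B); first by rewrite !addr_ge0 ?ltW.
exists (fun a b => alpha ^+ (a + b) + (A * alpha ^+ a
                   + (B * 1 + - B * barrier a b))).
have stepE a b : step (fun a b => alpha ^+ (a + b) + (A * alpha ^+ a
      + (B * 1 + - B * barrier a b))) a b
    = step (fun a b => alpha ^+ (a + b)) a b
      + (A * step (fun a _ => alpha ^+ a) a b + (B * 1 - B * step barrier a b)).
  by rewrite /step !mean_stepD !mean_stepZ mean_step_const // mulNr.
split.
- move=> a b ab0; rewrite stepE.
  have barr := mean_step_barrier _ _ ab0.
  case: a b ab0 barr => [|a] [|b] // _ barr.
  + rewrite /step mean_step_total_busy // mean_step_first_idle // -/K -/d2.
    have := ler_wpM2l (ltW B0) (mean_step_barrier_idle b).
    have := key b; rewrite expr0 add0n.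
    set x := alpha ^+ _; set y := mu2 ^+ _; set z := barrier _ _.
    set w := mean_step _ _ _ _ _ _.
    lra.
  + rewrite /step mean_step_total_idle // mean_step_first_busy // -/K -/d1 addn0.
    have := ler_wpM2l (ltW B0) barr.
    rewrite mulrDl mulrBl !mul1r -AE.
    set x := alpha ^+ _; set z := barrier _ _; set w := mean_step _ _ _ _ _ _.
    lra.
  + rewrite /step mean_step_total_busy // mean_step_first_busy // -/d1 -/d2.
    have := ler_wpM2l (ltW B0) barr.
    have := d2pow (a.+1 + b.+1)%N.
    have : 0 <= A * (d1 * alpha ^+ a.+1).
      by apply: mulr_ge0; [exact: ltW|apply: mulr_ge0; [exact: ltW|]].
    set x := alpha ^+ (_ + _); set x' := alpha ^+ _.
    set z := barrier _ _; set w := mean_step _ _ _ _ _ _.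
    lra.
- move=> a b; rewrite lerDl addr_ge0 //.
    by rewrite mulr_ge0 // ltW.
  by rewrite mulNr -mulrBr mulr_ge0 ?subr_ge0 ?barrier_le1 // ltW.
- move=> a; rewrite addn0 !mulrDl mul1r -addrA lerD2l lerD2l.
  apply: (@le_trans _ _ (B * 1)).
    by rewrite gerDl mulNr oppr_le0 mulr_ge0 ?barrier_ge0 // ltW.
  by rewrite ler_wpM2l ?exprn_ege1 ?ltW.
Qed.

(** The factors are such that the drift [mu2 - lambda] of the length cancels
    that of [alpha ^ a] on the vertical axis exactly. *)
Definition tilt a b : R :=
  (mu2 - lambda) * alpha ^+ a + growth lambda alpha * (a + b)%:R.

Lemma tilt_superharmonic a b :
  mean_step lambda mu1 mu2 tilt a b.+1 <= tilt a b.+1.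
Proof.
rewrite /tilt mean_stepD !mean_stepZ mean_step_length //.
case: a => [|a].
  rewrite mean_step_first_idle // expr0 le_eqVlt.
  by apply/orP; left; apply/eqP; ring.
have lm2 : 0 <= mu2 - lambda.
  by rewrite subr_ge0 (le_trans _ (ltW alpha_lt2)) // ler_peMr ?ltW.
rewrite mean_step_first_busy // lerD ?ler_wpM2l //.
- apply: ler_piMl; first by rewrite exprn_ge0 ?ltW.
  by rewrite gerDl oppr_le0 ltW ?decay_gt0.
- by rewrite ltW ?growth_gt0.
- by rewrite gerDl oppr_le0.
Qed.

End EscapeFunctions.

(** * Averages over words of increments *)

Definition arrival : int * int := (1, 0).
Definition transfer : int * int := (-1, 1).
Definition departure : int * int := (0, -1).

Definition steps : seq (int * int) := [:: arrival; transfer; departure].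

Definition move (z v : int * int) : int * int :=
  if in_quadrant (z + v) then z + v else z.

(** The walk is defined by its last step; conditioning on the first increment
    needs this decomposition by the first one. *)
Lemma tandem_walk_shift J z k :
  tandem_walk J z k.+1 = tandem_walk (fun l => J l.+1) (move z (J 0%N)) k.
Proof. by elim: k => [//|k IH]; rewrite /= -/(tandem_walk J z k.+1) IH. Qed.

Lemma in_quadrantE (i j : int) : in_quadrant (i, j) = (0 <= i) && (0 <= j).
Proof. by []. Qed.

Lemma move_arrival (a b : nat) :
  move (a%:Z, b%:Z) arrival = (a.+1%:Z, b%:Z).
Proof.
rewrite /move /arrival (_ : _ + _ = (a.+1%:Z, b%:Z)) ?in_quadrantE //.
by congr (_, _); rewrite /=; lia.
Qed.

Lemma move_transfer (a b : nat) :
  move (a%:Z, b%:Z) transfer = if a is a'.+1 then (a'%:Z, b.+1%:Z)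
                               else (a%:Z, b%:Z).
Proof.
case: a => [|a]; rewrite /move /transfer.
  by rewrite (_ : _ + _ = (-1, b.+1%:Z)) ?in_quadrantE //; congr (_, _); rewrite /=; lia.
rewrite (_ : _ + _ = (a%:Z, b.+1%:Z)) ?in_quadrantE //.
by congr (_, _); rewrite /=; lia.
Qed.

Lemma move_departure (a b : nat) :
  move (a%:Z, b%:Z) departure = if b is b'.+1 then (a%:Z, b'%:Z)
                                else (a%:Z, b%:Z).
Proof.
case: b => [|b]; rewrite /move /departure.
  rewrite (_ : _ + _ = (a%:Z, -1)) ?in_quadrantE ?andbF //.
  by congr (_, _); rewrite /=; lia.
rewrite (_ : _ + _ = (a%:Z, b%:Z)) ?in_quadrantE //.
by congr (_, _); rewrite /=; lia.
Qed.

Section WordProb.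
Context {R : realType} (lambda mu1 mu2 : R).
Context (lambda_gt0 : 0 < lambda).
Context (mu1_gt0 : 0 < mu1).
Context (mu2_gt0 : 0 < mu2).
Context (rates_sum1 : lambda + mu1 + mu2 = 1).

(** The probability that a word of [m] independent increments lies in [Q], as a
    recursion on the first increment rather than as a sum over words: this is
    the form in which [mean_step] appears. *)
Fixpoint word_prob (m : nat) (Q : set (seq (int * int))) : R :=
  if m is m'.+1 then
    lambda * word_prob m' [set s | Q (arrival :: s)]
    + mu1 * word_prob m' [set s | Q (transfer :: s)]
    + mu2 * word_prob m' [set s | Q (departure :: s)]
  else (asbool (Q [::]))%:R.

Lemma word_prob_mono m (Q Q' : set (seq (int * int))) :
  (forall s, {subset s <= steps} -> Q s -> Q' s) ->
  word_prob m Q <= word_prob m Q'.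
Proof.
elim: m Q Q' => [|m IH] Q Q' QQ' /=.
  case: asboolP => [q|_]; last by rewrite ler0n.
  by rewrite asboolT //; exact: QQ'.
have mono v : v \in steps ->
    word_prob m [set s | Q (v :: s)] <= word_prob m [set s | Q' (v :: s)].
  move=> vs; apply: IH => s ss; apply: QQ' => u; rewrite inE => /predU1P[->//|].
  exact: ss.
by rewrite !lerD //; apply: ler_wpM2l; do ?exact: ltW; exact: mono.
Qed.

Lemma word_prob_empty m Q : (forall s, ~ Q s) -> word_prob m Q = 0.
Proof.
elim: m Q => [|m IH] Q nQ /=; first by rewrite asboolF.
by rewrite !IH ?mulr0 ?addr0 // => s; apply: nQ.
Qed.

Lemma word_prob_le1 m Q : word_prob m Q <= 1.
Proof.
elim: m Q => [|m IH] Q /=; first by rewrite lern1 leq_b1.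
by rewrite -rates_sum1 !lerD //; apply: ler_piMr => //; exact: ltW.
Qed.

Definition walk_prob (m : nat) (E : set (nat -> int * int)) (a b : nat) : R :=
  word_prob m [set s | E (tandem_walk (nth 0 s) (a%:Z, b%:Z))].

(** Since [nth 0] continues a word by null increments, the coordinate sum of the
    path grows by at most one per step even beyond the end of the word. *)
Lemma walk_prob_mono m (E E' : set (nat -> int * int)) a b :
  (forall X, X 0%N = (a%:Z, b%:Z) ->
     (forall l, (X l.+1).1 + (X l.+1).2 <= (X l).1 + (X l).2 + 1) ->
     E X -> E' X) ->
  walk_prob m E a b <= walk_prob m E' a b.
Proof.
move=> EE'; apply: word_prob_mono => s ss; apply: EE' => // l /=.
set z := tandem_walk _ _ l.
have : nth 0 s l \in 0 :: steps.
  have [ls|sl] := ltnP l (size s); last by rewrite nth_default.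
  by rewrite inE ss ?orbT // mem_nth.
case: ifP => _; last by lia.
by rewrite !inE => /or4P[]/eqP -> /=; lia.
Qed.

Lemma walk_prob_first_step m (E : set (nat -> int * int)) a b :
  walk_prob m.+1 [set X | E (fun l => X l.+1)] a b
  = mean_step lambda mu1 mu2 (walk_prob m E) a b.
Proof.
have shift v s : (fun l => tandem_walk (nth 0 (v :: s)) (a%:Z, b%:Z) l.+1)
    = tandem_walk (nth 0 s) (move (a%:Z, b%:Z) v).
  by apply: funext => k; rewrite tandem_walk_shift.
rewrite /walk_prob /mean_step /=.
congr (_ * _ + _ * _ + _ * _).
- by congr word_prob; apply: funext => s; apply: (congr1 E);
    rewrite shift move_arrival.
- by case: a shift => [|a] shift; congr word_prob; apply: funext => s;
    apply: (congr1 E); rewrite shift move_transfer.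
- by case: b shift => [|b] shift; congr word_prob; apply: funext => s;
    apply: (congr1 E); rewrite shift move_departure.
Qed.

(** Optional stopping: the value of a superharmonic function does not increase
    on average while the walk is in [D], so that it bounds the probability of
    [E] as soon as it does so where the walk leaves [D].  The index of [E] is
    the remaining time. *)
Lemma walk_prob_superharmonic (E : nat -> set (nat -> int * int))
    (D : nat -> nat -> Prop) (f : nat -> nat -> R) :
  (forall m a b, ~ D a b -> walk_prob m (E m) a b <= f a b) ->
  (forall a b, D a b -> 0 <= f a b) ->
  (forall a b, D a b -> mean_step lambda mu1 mu2 f a b <= f a b) ->
  (forall X a b, X 0%N = (a%:Z, b%:Z) -> D a b -> ~ E 0%N X) ->
  (forall m X a b, X 0%N = (a%:Z, b%:Z) -> D a b ->
     E m.+1 X -> E m (fun l => X l.+1)) ->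
  forall m a b, walk_prob m (E m) a b <= f a b.
Proof.
move=> stop f0 superf start shift; elim=> [|m IH] a b.
  have [Dab|nDab] := pselect (D a b); last exact: stop.
  rewrite [X in X <= _]word_prob_empty ?f0 // => s.
  exact: start Dab.
have [Dab|nDab] := pselect (D a b); last exact: stop.
apply: le_trans (superf _ _ Dab).
apply: (@le_trans _ _ (walk_prob m.+1 [set X | E m (fun l => X l.+1)] a b)).
  by apply: walk_prob_mono => X X0 _; exact: shift X0 Dab.
rewrite walk_prob_first_step /mean_step.
rewrite !lerD //; apply: ler_wpM2l; do ?exact: ltW; do ?exact: IH;
  by [case: a {Dab} => [|a]; apply: IH|case: b {Dab} => [|b]; apply: IH].
Qed.

(** The visit is the first one, so that the strong Markov property at its time
    is the concatenation of two stopping problems. *)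
Definition visit_then (V : set (int * int)) (E : nat -> set (nat -> int * int))
    (m : nat) : set (nat -> int * int) :=
  [set X | exists i, [/\ (i <= m)%N, V (X i), (forall l, (l < i)%N -> ~ V (X l))
                       & E (m - i)%N (fun l => X (i + l)%N)]].

(** The case of optional stopping whose terminal reward is the probability of the
    sequel [E]. *)
Lemma visit_then_bound V E f :
  (forall m a b, V (a%:Z, b%:Z) -> walk_prob m (E m) a b <= f a b) ->
  (forall a b, 0 <= f a b) ->
  (forall a b, ~ V (a%:Z, b%:Z) -> mean_step lambda mu1 mu2 f a b <= f a b) ->
  forall m a b, walk_prob m (visit_then V E m) a b <= f a b.
Proof.
move=> stop f0 superf.
apply: (@walk_prob_superharmonic _ (fun a b => ~ V (a%:Z, b%:Z))) => //.
- move=> m a b /contrapT Vab.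
  apply: le_trans (stop m a b Vab); apply: walk_prob_mono => X X0 _ [[|i] [_ Vi]].
    by move=> _; rewrite subn0.
  by move=> /(_ 0%N) /(_ isT); rewrite X0.
- move=> X a b X0 nV [i [+ + _ _]].
  by rewrite leqn0 => /eqP ->; rewrite X0.
- move=> m X a b X0 nV [[|i] [im Vi first Ei]]; first by rewrite X0 in Vi.
  exists i; split => //; first by move=> l li; exact: first.
Qed.

Definition exits_before_origin (n m : nat) : set (nat -> int * int) :=
  [set X | exists k, [/\ (k <= m)%N, (X k).1 + (X k).2 = n%:Z
                       & forall l, (l <= k)%N -> X l <> (0, 0)]].

Lemma exits_before_origin_bound (alpha : R) (n : nat) (f : nat -> nat -> R) :
  0 < alpha ->
  (forall a b, (0 < a + b)%N -> mean_step lambda mu1 mu2 f a b <= f a b) ->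
  (forall a b, alpha ^+ (a + b) <= f a b) ->
  forall m a b,
    walk_prob m (exits_before_origin n m) a b <= alpha ^- n * f a b.
Proof.
move=> alpha0 superf fge.
have f0 a b : 0 <= alpha ^- n * f a b.
  apply: mulr_ge0; first by rewrite invr_ge0 exprn_ge0 ?ltW.
  by apply: le_trans (fge a b); rewrite exprn_ge0 ?ltW.
apply: (@walk_prob_superharmonic _ (fun a b => (0 < a + b)%N /\ (a + b)%N <> n)).
- move=> m a b /not_andP[/negP|/contrapT abn].
    rewrite -eqn0Ngt addn_eq0 => /andP[/eqP -> /eqP ->].
    rewrite /walk_prob word_prob_empty ?f0 // => s [k [_ _ /(_ 0%N)]].
    exact.
  apply: (le_trans (word_prob_le1 _ _)).
  by rewrite ler_pdivlMl ?exprn_gt0 // mulr1 -{1}abn.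
- by move=> a b _.
- move=> a b [ab0 _]; rewrite mean_stepZ ler_wpM2l ?superf //.
  by rewrite invr_ge0 exprn_ge0 ?ltW.
- move=> X a b X0 [_ abn] [k [+ + _]].
  rewrite leqn0 => /eqP ->; rewrite X0 /=.
  lia.
- move=> m X a b X0 [_ abn] [[|k] [km sumk avoid]].
    by move: sumk; rewrite X0 /=; lia.
  by exists k; split => // l lk; exact: avoid.
Qed.

(** The visits of the axes at times [i] and [j] need not be the first ones: they
    are preceded by first ones that satisfy the same constraints. *)
Definition crossing (n m : nat) : set (nat -> int * int) :=
  [set X | exists i j k, [/\ (i < j)%N /\ (k <= m)%N, (X i).1 = 0, (X j).2 = 0,
       forall l, (l <= j)%N -> (X l).1 + (X l).2 <> n%:Z
     & (X k).1 + (X k).2 = n%:Z /\ forall l, (l <= k)%N -> X l <> (0, 0)]].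

(** The bound on the sum in the first target makes a constant sufficient as
    superharmonic function of the first stage. *)
Definition staged_crossing (n : nat) : nat -> set (nat -> int * int) :=
  visit_then [set z | z.1 = 0 /\ z.1 + z.2 <= n%:Z]
    (visit_then [set z | z.2 = 0] (exits_before_origin n)).

(** Take the first visit of each axis.  The path climbs by at most one per step
    and has not met the line of sum [n] before time [j], so it is below that
    line at the first visit of the vertical axis. *)
Lemma crossing_staged n m X :
  (X 0%N).1 + (X 0%N).2 <= n%:Z ->
  (forall l, (X l.+1).1 + (X l.+1).2 <= (X l).1 + (X l).2 + 1) ->
  crossing n m X -> staged_crossing n m X.
Proof.
move=> X0 unit_up [i [j [k [[ij km] Xi Xj below [Xk avoid]]]]].
have leN l : (l <= j)%N -> (X l).1 + (X l).2 <= n%:Z.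
  elim: l => [//|l IH] lj; apply: le_trans (unit_up l) _.
  rewrite lezD1 lt_neqAle IH ?(ltnW lj) // andbT.
  by apply/eqP/below/ltnW.
have jk : (j < k)%N by rewrite ltnNge; apply/negP => kj; exact: below Xk.
pose V l := ((X l).1 == 0) && ((X l).1 + (X l).2 <= n%:Z).
have exV : exists l, V l by exists i; rewrite /V Xi eqxx -Xi leN // ltnW.
case: (ex_minnP exV) => i' /andP[/eqP Xi' Ni'] min_i'.
have i'i : (i' <= i)%N by apply: min_i'; rewrite /V Xi eqxx -Xi leN // ltnW.
have exW : exists l, (X (i' + l)%N).2 == 0.
  by exists (j - i')%N; rewrite subnKC ?Xj //; lia.
case: (ex_minnP exW) => j' /eqP Xj' min_j'.
have j'j : (i' + j' <= j)%N.
  rewrite -leq_subRL; last by lia.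
  by apply: min_j'; rewrite subnKC ?Xj //; lia.
exists i'; split => //.
- by lia.
- move=> l li' [Xl Nl].
  by have := min_i' l; rewrite /V Xl eqxx -Xl Nl => /(_ isT); rewrite leqNgt li'.
- exists j'; split => //.
  + by lia.
  + move=> l lj' Xl; have := min_j' l.
    by rewrite Xl eqxx => /(_ isT); rewrite leqNgt lj'.
  + exists (k - (i' + j'))%N; split.
    * by lia.
    * by rewrite addnA subnKC //; lia.
    * by move=> l lk; apply: avoid; lia.
Qed.

Context (alpha : R) (alpha_gt1 : 1 < alpha).
Context (alpha_lt1 : lambda * alpha < mu1) (alpha_lt2 : lambda * alpha < mu2).

(** The superharmonic functions of the three stages match on the axes: [f] is at
    most [D * tilt] on the horizontal axis, and [tilt] is at most a multiple of
    [1 + n] on the part of the vertical axis below the line of sum [n]. *)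
Lemma staged_crossing_bound :
  exists2 C : R, 0 <= C & forall n m a b,
    walk_prob m (staged_crossing n m) a b <= alpha ^- n * (C * (1 + n%:R)).
Proof.
have lambda_lt mu : lambda * alpha < mu -> lambda < mu.
  by apply: le_lt_trans; rewrite ler_peMr ?ltW.
have alpha_gt0 : 0 < alpha := lt_trans ltr01 alpha_gt1.
have inv0 n : 0 <= alpha ^- n by rewrite invr_ge0 exprn_ge0 ?ltW.
have [C C0 [f [superf f_ge f_le]]] := escape_superharmonic _ _ _ lambda_gt0
  mu1_gt0 mu2_gt0 rates_sum1 (lambda_lt _ alpha_lt1) _ alpha_gt1 alpha_lt1
  alpha_lt2.
have gap : 0 < mu2 - lambda by rewrite subr_gt0 lambda_lt.
have G0 := growth_gt0 _ lambda_gt0 _ alpha_gt1.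
set G := growth _ _ in G0; pose D := C / (mu2 - lambda).
have D0 : 0 <= D by rewrite divr_ge0 // ltW.
pose t := tilt lambda mu2 alpha.
have t_ge0 a b : 0 <= t a b.
  by apply: addr_ge0; rewrite mulr_ge0 ?ler0n ?exprn_ge0 ?(ltW G0) ?ltW.
exists (D * (mu2 - lambda + G)); first by rewrite mulr_ge0 // addr_ge0 ?ltW.
move=> n; apply: visit_then_bound => [m a b [/= [->] bn]||].
- apply: (@le_trans _ _ (alpha ^- n * (D * t 0%N b))); last first.
    rewrite ler_wpM2l // -mulrA ler_wpM2l // /t /tilt -/G expr0 mulr1 add0n.
    rewrite mulrDl lerD //.
      by rewrite ler_peMr ?lerDl ?ler0n // ltW.
    rewrite ler_pM2l //; apply: ler_wpDl => //.
    by move: bn; rewrite add0r lez_nat ler_nat.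
  move: m (0%N) b {a bn}; apply: visit_then_bound => [m a b [/= [->]]|a b|a b].
  + apply: (le_trans (exits_before_origin_bound _ _ _ alpha_gt0 superf f_ge _ _ _)).
    rewrite ler_wpM2l // (le_trans (f_le a)) // /t /tilt mulrDr mulrA divfK.
      rewrite lerDl; apply: mulr_ge0 => //.
      by apply: mulr_ge0; [exact: ltW|exact: ler0n].
    by rewrite gt_eqF.
  + by apply: mulr_ge0 => //; exact: mulr_ge0.
  + case: b => [/(_ erefl)//|b] _; rewrite !mean_stepZ ler_wpM2l // ler_wpM2l //.
    exact: tilt_superharmonic.
- move=> a b; rewrite mulr_ge0 // mulr_ge0 ?addr_ge0 ?ler0n //.
  by apply: mulr_ge0 => //; rewrite addr_ge0 // ltW.
- by move=> a b _; rewrite mean_step_const.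
Qed.

Lemma crossing_bound :
  exists2 C : R, 0 <= C & forall n m a b, (a + b <= n)%N ->
    walk_prob m (crossing n m) a b <= alpha ^- n * (C * (1 + n%:R)).
Proof.
have [C C0 bound] := staged_crossing_bound; exists C => // n m a b abn.
apply: le_trans (bound n m a b); apply: walk_prob_mono => X X0 up.
by apply: crossing_staged => //; rewrite X0 -PoszD lez_nat.
Qed.

End WordProb.

(** * The law of the first increments *)

Section Words.
Context {R : realType} {d : measure_display} {T : measurableType d}
  {P : probability T R} (I : nat -> {RV P >-> (int * int)%type}).

Definition word (m : nat) (w : T) : seq (int * int) :=
  mkseq (fun k => I k w) m.

Lemma measurable_lattice_point (z : int * int) : measurable [set z].
Proof.
rewrite (_ : [set z] = [set z.1] `*` [set z.2]); first exact: measurableX.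
by case: z => i j; apply/seteqP; split => -[i' j'] /=; [case=> -> ->|case=> -> ->].
Qed.

Lemma word_eqE m s : size s = m ->
  [set w | word m w = s] =
  \bigcap_(k in [set` [fset l in iota 0 m]%fset]) (I k @^-1` [set nth 0 s k]).
Proof.
move=> sz; apply/seteqP; split => w /=.
  by move=> <- k; rewrite /= !inE mem_iota /= => km; rewrite nth_mkseq.
move=> ws; apply: (@eq_from_nth _ 0); rewrite size_mkseq // => k km.
by rewrite nth_mkseq //; apply: ws; rewrite /= !inE mem_iota.
Qed.

Lemma measurable_word_eq m s : measurable [set w | word m w = s].
Proof.
have [sz|sz] := eqVneq (size s) m.
  rewrite word_eqE //; apply: bigcap_measurableType => k _.
  exact: measurable_funPTI (measurable_lattice_point _).
rewrite (_ : [set w | _] = set0) //; apply/seteqP; split => // w /= ws.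
by move: sz; rewrite -ws size_mkseq eqxx.
Qed.

Lemma measurable_word m (Q : set (seq (int * int))) :
  measurable [set w | Q (word m w)].
Proof.
rewrite (_ : [set w | _] =
    \bigcup_s ([set w | word m w = s] `&` [set w | Q s])).
  apply: countable_bigcupT_measurable => // s.
  have [Qs|nQs] := pselect (Q s).
    rewrite (_ : [set w | Q s] = setT); last by apply/seteqP; split.
    by rewrite setIT; exact: measurable_word_eq.
  rewrite (_ : [set w | Q s] = set0); last by apply/seteqP; split.
  by rewrite setI0.
apply/seteqP; split => w /=; first by exists (word m w).
by case=> s _ [/= -> ].
Qed.

Context (I_independent : mutually_independent I).

Lemma word_law m s : size s = m ->
  (P [set w | word m w = s] = \prod_(0 <= k < m) P (I k @^-1` [set nth 0%R s k]))%E.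
Proof.
move=> sz; rewrite word_eqE // I_independent; last first.
  by move=> k; exact: measurable_lattice_point.
apply: perm_big; apply: uniq_perm; [exact: fset_uniq|exact: iota_uniq|] => k.
by rewrite mem_index_iota !inE mem_iota.
Qed.

(** The next increment is independent of the past. *)
Lemma word_law_rcons m s v : size s = m ->
  (P [set w | word m.+1 w = rcons s v]
   = P [set w | word m w = s] * P (I m @^-1` [set v]))%E.
Proof.
move=> sz; rewrite !word_law ?size_rcons ?sz // big_nat_recr //=.
rewrite nth_rcons sz ltnn eqxx; congr (_ * _)%E.
by apply: eq_big_nat => k /andP[_ km]; rewrite nth_rcons sz km.
Qed.

Context (lambda mu1 mu2 : R).
Context (rates_sum1 : lambda + mu1 + mu2 = 1).
Context (I_law : forall k, increment_law lambda mu1 mu2 (I k)).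

Lemma measurable_increment k (Q : set (int * int)) :
  measurable [set w | Q (I k w)].
Proof.
have := measurable_word k.+1 [set s | Q (nth 0 s k)].
by congr (measurable _); apply/seteqP; split => w /=; rewrite nth_mkseq.
Qed.

(** The three prescribed probabilities add up to one. *)
Lemma increment_in_steps k : P [set w | I k w \notin steps] = 0%E.
Proof.
have [La Lt Ld] := I_law k.
have mk v : measurable [set w | I k w = v] := measurable_increment k [set v].
have -> : [set w | I k w \notin steps] = ~` (([set w | I k w = arrival] `|`
     [set w | I k w = transfer]) `|` [set w | I k w = departure]).
  apply/seteqP; split => w /=.
    by rewrite !inE => nw [[]|] e; rewrite e in nw.
  move=> nw; rewrite !inE; apply/negP => /or3P[]/eqP e; apply: nw; tauto.
rewrite probability_setC; last by do 2?apply: measurableU.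
rewrite !measureU //; do ?exact: measurableU.
- transitivity (1 - (lambda%:E + mu1%:E + mu2%:E))%E.
    by congr (1 - (_ + _ + _))%E.
  by rewrite -!EFinD rates_sum1 subrr.
- by apply/seteqP; split => // w /= [-> ].
- by apply/seteqP; split => // w /= [[->|->]].
Qed.

(** Induction on the number of increments still to be drawn, conditionally on
    the word [u] already drawn: the next increment is almost surely one of the
    three steps and it extends [u] by an independent letter. *)
Lemma prob_word_le m (Q : set (seq (int * int))) :
  (P [set w | Q (word m w)] <= (word_prob lambda mu1 mu2 m Q)%:E)%E.
Proof.
suff gen k u : size u = k ->
    (P ([set w | word k w = u] `&` [set w | Q (word (k + m) w)])
     <= P [set w | word k w = u]
        * (word_prob lambda mu1 mu2 m [set s | Q (u ++ s)])%:E)%E.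
  have := gen 0%N [::] erefl.
  rewrite (_ : [set w | word 0 w = [::]] = setT); last by apply/seteqP; split.
  by rewrite setTI probability_setT mul1e.
elim: m k u => [|m IH] k u sz /=.
  rewrite cats0 addn0; case: asboolP => Qu.
    rewrite mule1; apply: le_measure; rewrite ?inE //.
    - by apply: measurableI; [exact: measurable_word_eq|exact: measurable_word].
    - exact: measurable_word_eq.
  rewrite mule0 (_ : _ `&` _ = set0) ?measure0 //.
  by apply/seteqP; split => // w /= [-> /Qu].
pose F v := [set w | word k.+1 w = rcons u v]
            `&` [set w | Q (word (k.+1 + m) w)].
have mF v : measurable (F v).
  by apply: measurableI; [exact: measurable_word_eq|exact: measurable_word].
have F_le v p : distribution P (I k) [set v] = p%:E ->
    (P (F v) <= P [set w | word k w = u]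
       * (p * word_prob lambda mu1 mu2 m [set s | Q (u ++ v :: s)])%:E)%E.
  move=> pv; have := IH k.+1 (rcons u v).
  rewrite size_rcons sz => /(_ erefl) /le_trans; apply.
  rewrite word_law_rcons // [P (_ @^-1` _)]pv EFinM muleA.
  by under [X in word_prob _ _ _ _ X]eq_set do rewrite cat_rcons.
have [La Lt Ld] := I_law k.
pose N := [set w | I k w \notin steps].
have mN : measurable N := measurable_increment k [set v | v \notin steps].
apply: (@le_trans _ _ (P (((F arrival `|` F transfer) `|` F departure) `|` N))).
  apply: le_measure; rewrite ?inE.
  - by apply: measurableI; [exact: measurable_word_eq|exact: measurable_word].
  - by do 3?apply: measurableU.
  - move=> w /= [wu Qw].
    have wk v : I k w = v -> F v w.
      by move=> <-; split; rewrite /= ?addSnnS // -wu /word mkseqS.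
    rewrite /N /=; case: (boolP (I k w \in steps)); last by right.
    by rewrite !inE => /or3P[]/eqP /wk ?; left; [left; left|left; right|right].
apply: le_trans (measureU2 _ _ _) _; do ?[exact: mN|by do 2?apply: measurableU].
rewrite -[leRHS]adde0; apply: leeD; last first.
  by rewrite le_eqVlt; apply/orP; left; apply/eqP; exact: increment_in_steps.
have finP : P [set w | word k w = u] \is a fin_num.
  by rewrite fin_num_measure //; exact: measurable_word_eq.
rewrite !EFinD !muleDr ?fin_num_adde_defl //.
apply: le_trans (measureU2 _ _ _) _ => //; first exact: measurableU.
apply: leeD; last exact: F_le.
apply: le_trans (measureU2 _ _ _) _ => //.
by apply: leeD; exact: F_le.
Qed.
End Words.

(** * The order of the hitting times *)

Lemma first_time_ltP (R : realType) (Q Q' : set nat) :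
  (first_time R Q < first_time R Q')%E <->
  exists2 k, Q k & forall l, (l <= k)%N -> ~ Q' l.
Proof.
split=> [/ereal_inf_lt[_ [k Qk <-] kQ']|[k Qk nQ']].
  exists k => // l lk Q'l; move: kQ'; apply/negP; rewrite -leNgt.
  apply: (@le_trans _ _ (l%:R)%:E); last by rewrite lee_fin ler_nat.
  by apply: ereal_inf_lbound; exists l.
apply: (@le_lt_trans _ _ (k%:R)%:E); first by apply: ereal_inf_lbound; exists k.
apply: (@lt_le_trans _ _ (k.+1%:R)%:E); first by rewrite lte_fin ltr_nat.
apply/ereal_infP => _ [l Q'l <-]; rewrite lee_fin ler_nat ltnNge.
by apply/negP => /nQ'.
Qed.

Lemma first_time_lt_natP (R : realType) (Q : set nat) k :
  (first_time R Q < (k%:R)%:E)%E <-> exists2 l, (l < k)%N & Q l.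
Proof.
split=> [/ereal_inf_lt[_ [l Ql <-]]|[l lk Ql]].
  by rewrite lte_fin ltr_nat => lk; exists l.
apply: (@le_lt_trans _ _ (l%:R)%:E); first by apply: ereal_inf_lbound; exists l.
by rewrite lte_fin ltr_nat.
Qed.

(** The event only compares first times, and each comparison is decided by a
    finite piece of the path; hence the event is a countable union of
    cylinders. *)
Lemma hitting_order_crossing (R : realType) (X : nat -> int * int) n :
  [/\ (sigma1 R X < sigma12 R X)%E, (sigma12 R X < tau R X n)%E
     & (tau R X n < tau0 R X)%E] <-> exists m, crossing n m X.
Proof.
split=> [[_ /first_time_ltP[j [sj Xj] nj] /first_time_ltP[k Xk nk]]|].
  have [i ij Xi] := (first_time_lt_natP _ _ _).1 sj.
  by exists k, i, j, k; split.
case=> m [i [j [k [[ij km] Xi Xj nj [Xk nk]]]]]; split.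
- apply/first_time_ltP.
  have exV : exists l, (X l).1 == 0 by exists i; rewrite Xi.
  case: (ex_minnP exV) => i' /eqP Xi' min_i'; exists i' => // l li' [sl _].
  have [l' l'l Xl'] := (first_time_lt_natP _ _ _).1 sl.
  have := min_i' l'; rewrite Xl' eqxx => /(_ isT); lia.
- apply/first_time_ltP; exists j => //.
  by split=> //; apply/first_time_lt_natP; exists i.
- by apply/first_time_ltP; exists k.
Qed.

Lemma crossing_local n m X Y :
  (forall l, (l <= m)%N -> X l = Y l) -> crossing n m X -> crossing n m Y.
Proof.
move=> XY [i [j [k [[ij km] Xi Xj nj [Xk nk]]]]].
have jk : (j < k)%N by rewrite ltnNge; apply/negP => kj; exact: nj Xk.
have le_m l : (l <= k)%N -> (l <= m)%N by move=> /leq_trans; apply.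
have jm := le_m _ (ltnW jk).
exists i, j, k; split=> //.
- by rewrite -XY // (leq_trans (ltnW ij)).
- by rewrite -XY.
- by move=> l lj; rewrite -XY; [exact: nj|exact: leq_trans lj jm].
- split; first by rewrite -XY.
  by move=> l lk; rewrite -XY; [exact: nk|exact: le_m].
Qed.

Lemma tandem_walk_prefix J J' x m :
  (forall l, (l < m)%N -> J l = J' l) ->
  forall l, (l <= m)%N -> tandem_walk J x l = tandem_walk J' x l.
Proof.
by move=> JJ'; elim=> [//|l IH] lm /=; rewrite IH ?JJ' // ltnW.
Qed.

(** * The estimate *)

(** [expR (n * e)] is at least the square of [n * e / 2]. *)
Lemma linear_le_expR (R : realType) (C e : R) : 0 <= C -> 0 < e ->
  exists N : nat, forall n : nat, (N < n)%N ->
    C * (1 + n%:R) <= expR (n%:R * e).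
Proof.
move=> C0 e0; exists (Num.bound (8 * C / e ^+ 2)) => n Nn.
have n1 : 1 <= n%:R :> R by rewrite ler1n (leq_trans _ Nn).
have en : 8 * C <= e ^+ 2 * n%:R.
  rewrite -ler_pdivrMl ?exprn_gt0 // mulrC.
  apply: (le_trans (ltW (unstable.ltr_bound _))).
  by rewrite ler_nat ltnW.
rewrite (_ : n%:R * e = 2%:R * (n%:R * e / 2)); last by field.
rewrite expRM_natl.
have h : n%:R * e / 2 <= expR (n%:R * e / 2).
  by apply: le_trans (expR_ge1Dx _); rewrite lerDr.
have h0 : 0 <= n%:R * e / 2 by rewrite divr_ge0 ?mulr_ge0 ?ler0n // ltW.
apply: (@le_trans _ _ ((n%:R * e / 2) ^+ 2)); last first.
  by rewrite lerXn2r ?nnegrE // (le_trans h0).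
rewrite (_ : (n%:R * e / 2) ^+ 2 = n%:R * (e ^+ 2 * n%:R) / 4); last by field.
have h1 : n%:R * (8 * C) <= n%:R * (e ^+ 2 * n%:R) by rewrite ler_wpM2l.
have h2 : C * 1 <= C * n%:R by rewrite ler_wpM2l.
by rewrite ler_pdivlMr //; lra.
Qed.


Theorem proposition7p3 (R : realType) (lambda mu1 mu2 : R)
    (lambda_gt0 : 0 < lambda) (mu1_gt0 : 0 < mu1) (mu2_gt0 : 0 < mu2)
    (rates_sum1 : lambda + mu1 + mu2 = 1)
    (stable1 : lambda < mu1) (stable2 : lambda < mu2)
    (d : measure_display) (T : measurableType d) (P : probability T R)
    (I : nat -> {RV P >-> (int * int)%type})
    (I_independent : mutually_independent I)
    (I_law : forall k, increment_law lambda mu1 mu2 (I k))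
    (x : R * R) (x1_ge0 : 0 <= x.1) (x2_ge0 : 0 <= x.2)
    (x_lt1 : x.1 + x.2 < 1)
    (eps : R) (eps_gt0 : 0 < eps) :
  exists N : nat, (0 < N)%N /\ forall n : nat, (N < n)%N ->
    (P [set w | let X := tandem_walk (fun k => I k w) (scaled_start x n) in
                [/\ sigma1 R X < sigma12 R X, sigma12 R X < tau R X n &
                    tau R X n < tau0 R X]]
     <= (expR (- (n%:R * (decay_rate lambda mu1 mu2 - eps))))%:E)%E.
Proof.
have ratio_lt mu : 0 < mu -> lambda < mu -> ln (lambda / mu) < 0.
  by move=> mu0 lm; rewrite ln_lt0 // divr_gt0 //= ltr_pdivrMr // mul1r.
pose gamma := decay_rate lambda mu1 mu2.
have gamma0 : 0 < gamma by rewrite oppr_gt0 gt_max !ratio_lt.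
(* [ln alpha] is positive and at most half of [eps] below the decay rate; the
   other half of [eps] pays for the linear factor. *)
pose theta := Num.min (eps / 2) (gamma / 2).
have theta0 : 0 < theta by rewrite lt_min !divr_gt0.
have theta_eps : theta <= eps / 2 by rewrite ge_min lexx.
have theta_gamma : theta < gamma.
  apply: (@le_lt_trans _ _ (gamma / 2)); first by rewrite ge_min lexx orbT.
  by rewrite ltr_pdivrMr // ltr_pMr // ltr1n.
pose alpha := expR (gamma - theta).
have alpha_gt1 : 1 < alpha by rewrite expR_gt1 subr_gt0.
have alpha_lt mu : 0 < mu -> ln (lambda / mu) <= - gamma -> lambda * alpha < mu.
  move=> mu0 le_gamma.
  rewrite mulrC -ltr_pdivlMr //.
  have -> : mu / lambda = expR (- ln (lambda / mu)).
    by rewrite expRN lnK ?posrE ?divr_gt0 // invf_div.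
  rewrite ltr_expR (@lt_le_trans _ _ gamma) ?gtrBl //.
  by rewrite lerNr.
have alpha_lt1 : lambda * alpha < mu1.
  by apply: alpha_lt => //; rewrite opprK le_max lexx.
have alpha_lt2 : lambda * alpha < mu2.
  by apply: alpha_lt => //; rewrite opprK le_max lexx orbT.
have [C C0 bound] := crossing_bound _ _ _ lambda_gt0 mu1_gt0 mu2_gt0 rates_sum1
  _ alpha_gt1 alpha_lt1 alpha_lt2.
have [N HN] := linear_le_expR _ _ _ C0 (divr_gt0 eps_gt0 (ltr0n R 2)).
exists N.+1; split=> // n Nn.
have [a [b [startE abn]]] : exists a b : nat,
    scaled_start x n = (a%:Z, b%:Z) /\ (a + b <= n)%N.
  have nx1 : 0 <= n%:R * x.1 by rewrite mulr_ge0 ?ler0n.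
  have nx2 : 0 <= n%:R * x.2 by rewrite mulr_ge0 ?ler0n.
  exists `|Num.floor (n%:R * x.1)|%N, `|Num.floor (n%:R * x.2)|%N.
  split; first by rewrite !gez0_abs ?floor_ge0.
  rewrite -lez_nat PoszD !gez0_abs ?floor_ge0 // -(ler_int R) intrD.
  apply: (@le_trans _ _ (n%:R * x.1 + n%:R * x.2)).
    by apply: lerD; exact: floor_le.
  by rewrite -mulrDr ler_piMr ?ler0n // ltW.
(* The events [F m] depend on the first [m] increments and increase to the event
   of the theorem, which is thereby measurable. *)
pose F m := [set w | crossing n m (tandem_walk (nth 0 (word I m w)) (a%:Z, b%:Z))].
have FE m w : F m w <-> crossing n m (tandem_walk (fun k => I k w) (a%:Z, b%:Z)).
  have prefix l : (l <= m)%N -> tandem_walk (nth 0 (word I m w)) (a%:Z, b%:Z) l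
      = tandem_walk (fun k => I k w) (a%:Z, b%:Z) l.
    by apply: tandem_walk_prefix => k km; rewrite nth_mkseq.
  by split; apply: crossing_local => l lm; rewrite prefix.
rewrite startE (_ : [set w | _] = \bigcup_m F m); last first.
  apply/seteqP; split=> w /=.
    by move=> /hitting_order_crossing[m Xm]; exists m => //; exact/FE.
  by case=> m _ /FE Xm; apply/hitting_order_crossing; exists m.
have mF m : measurable (F m).
  exact: (measurable_word _ _
    [set s | crossing n m (tandem_walk (nth 0 s) (a%:Z, b%:Z))]).
have cvgF : P \o F @ \oo --> P (\bigcup_m F m).
  apply: nondecreasing_cvg_mu => //; first exact: bigcupT_measurable.
  move=> m m' mm'; apply/subsetPset => w /FE.
  case=> i [j [k [[ij km] *]]]; apply/FE; exists i, j, k.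
  by split=> //; split=> //; exact: leq_trans km mm'.
rewrite -(cvg_lim _ cvgF) //; apply: lime_le; first exact: (cvgP _ cvgF).
apply: nearW => m /=.
apply: (le_trans (prob_word_le _ I_independent _ _ _ rates_sum1 I_law m
  [set s | crossing n m (tandem_walk (nth 0 s) (a%:Z, b%:Z))])).
rewrite lee_fin (le_trans (bound n m a b abn)) //.
rewrite /alpha -expRM_natl -expRN.
apply: (@le_trans _ _ (expR (- (n%:R * (gamma - theta))) * expR (n%:R * (eps / 2)))).
  by rewrite ler_wpM2l ?expR_ge0 // HN // ltnW.
rewrite -expRD ler_expR -mulrN -mulrDr -mulrN ler_wpM2l ?ler0n //.
by rewrite -/gamma; lra.
Qed.
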